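(* Let $d \ge 1$ be an integer. The vertices of the Gardner polytope $\mathcal{G}_d \subset \mathbb{R}^{d\times d}$ are exactly the matrices $R_1,\dots,R_d,C_1,\dots,C_d$.
   Context: Let $[d]=\{1,\dots,d\}$. A matrix $A\in\mathbb{R}^{d\times d}$ is a $G$-matrix of value $N\in\mathbb{R}_{\ge 0}$ if all its entries are nonnegative and $A_{1,\sigma(1)}+A_{2,\sigma(2)}+\cdots+A_{d,\sigma(d)}=N$ for every permutation $\sigma$ of $[d]$. The Gardner polytope $\mathcal{G}_d\subseteq\mathbb{R}^{d\times d}$ is the set of all $G$-matrices of value $1$; it is a bounded convex polyhedron. For $i=1,\dots,d$, $R_i\in\mathbb{R}^{d\times d}$ (respectively $C_i\in\mathbb{R}^{d\times d}$) is the matrix whose entries in the $i$th row (respectively $i$th column) are all $1$ and whose remaining entries are $0$. The vertices of a polytope $\mathcal{P}$ are the elements of the unique inclusion-minimal finite set $S$ with $\mathcal{P}=\operatorname{conv}(S)$ (equivalently, its extreme points). *)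

(* Defs.v *)
From mathcomp Require Import all_boot all_order all_algebra perm.
From mathcomp Require Import boolp classical_sets cardinality reals convex.

Set Implicit Arguments.
Unset Strict Implicit.
Unset Printing Implicit Defensive.

Import Order.TTheory GRing.Theory Num.Theory.

Local Open Scope classical_set_scope.
Local Open Scope ring_scope.

(* No hypothesis [0 <= N] is needed: it follows from the two clauses. *)
Definition G_matrix (R : realType) (d : nat) (N : R) (A : 'M[R]_d) : Prop :=
  (forall i j, 0 <= A i j) /\
  (forall s : 'S_d, \sum_(i < d) A i (s i) = N).

Definition gardner_polytope (R : realType) (d : nat) : set 'M[R]_d :=
  [set A | G_matrix 1 A].

Arguments gardner_polytope : clear implicits.

Definition R_matrix (R : realType) (d : nat) (i : 'I_d) : 'M[R]_d :=
  \matrix_(k, l) (k == i)%:R.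

Definition C_matrix (R : realType) (d : nat) (j : 'I_d) : 'M[R]_d :=
  \matrix_(k, l) (l == j)%:R.

Definition convex_hull (R : realType) (E : lmodType R) (S : set E) : set E :=
  smallest (@convex_set R E) S.

Definition generates (R : realType) (E : lmodType R) (P S : set E) : Prop :=
  finite_set S /\ convex_hull S = P.

Definition minimal_generating (R : realType) (E : lmodType R) (P S : set E)
  : Prop :=
  generates P S /\ (forall T, T `<=` S -> generates P T -> T = S).

(* [S] is the unique inclusion-minimal finite set whose convex hull is [P];
   both minimality and uniqueness are part of the assertion. *)
Definition is_vertex_set (R : realType) (E : lmodType R) (P S : set E)
  : Prop :=
  unique (minimal_generating P) S.

(* Main.v *)
(** A permutation and its composite with a transposition give the same sum, so a
    G-matrix satisfies [A i j + A k l = A i l + A k j] and hence has the form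
    [A i j = r i + c j]. Normalising by a smallest entry of one row makes [r] and
    [c] nonnegative, with total weight [1]: this writes [A] as a convex
    combination of the [R_i] and [C_j]. Conversely a zero entry of [R_i] forces
    a zero entry in both endpoints of a segment through [R_i], and a G-matrix
    vanishing off row [i] is [R_i]; so [R_i] is extreme, and likewise [C_j].
    Extreme points lie in every generating set. *)
Require Import Defs.
From mathcomp Require Import all_boot all_order all_algebra perm.
From mathcomp Require Import boolp classical_sets cardinality reals convex.
From mathcomp Require Import interval_inference lra.

Set Implicit Arguments.
Unset Strict Implicit.
Unset Printing Implicit Defensive.

Import Order.TTheory GRing.Theory Num.Theory.

Local Open Scope classical_set_scope.
Local Open Scope ring_scope.

(** Replaces coefficients bundled in the unit interval by plain reals strictly between 0 and 1; the
    two endpoints are trivial. *)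
Lemma convex_setE (R : realType) (E : lmodType R) (A : set E) :
  convex_set A <-> (forall x y (t : R), 0 < t -> t < 1 -> A x -> A y ->
    A (t *: x + (1 - t) *: y)).
Proof.
split=> [cA x y t t0 t1 Ax Ay|cA].
  by have := cA x y (Itv01 (ltW t0) (ltW t1)) (mem_set Ax) (mem_set Ay); move/set_mem.
apply/convex_setW => x y xA yA k k0 k1; apply/mem_set.
by apply: cA => //; apply: set_mem.
Qed.

(** Leaving the weights unnormalised lets the induction pass to the tail: the new barycentre joins
    [F a] to the tail barycentre with coefficient [w a / (w a + S)]. *)
Lemma convex_set_sum (R : realType) (E : lmodType R) (A : set E) (I : Type)
    (s : seq I) (w : I -> R) (F : I -> E) :
  convex_set A -> (forall i, 0 <= w i) -> (forall i, A (F i)) ->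
  0 < \sum_(i <- s) w i ->
  A ((\sum_(i <- s) w i)^-1 *: \sum_(i <- s) w i *: F i).
Proof.
move=> /convex_setE cA w0 AF; elim: s => [|a s IH]; first by rewrite big_nil ltxx.
rewrite !big_cons; set S := \sum_(i <- s) w i; set V := \sum_(i <- s) _ => wS0.
have S0 : 0 <= S by apply: sumr_ge0.
(* A tail of total weight zero has no barycentre, but then all its terms vanish. *)
have [S_eq0|S_neq0] := eqVneq S 0.
  have -> : V = 0.
    move: S_eq0; rewrite /S /V; clear -w0.
    elim: s => [|b s IH]; first by rewrite !big_nil.
    rewrite !big_cons => /eqP; rewrite paddr_eq0 ?sumr_ge0// => /andP[/eqP-> /eqP/IH].
    by rewrite scale0r add0r; apply.
  by move: wS0; rewrite S_eq0 !addr0 => wa0; rewrite scalerA mulVf ?scale1r ?gt_eqF.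
have {S_neq0}S_gt0 : 0 < S by rewrite lt_def S_neq0.
have [wa0|wa_neq0] := eqVneq (w a) 0; first by rewrite wa0 scale0r !add0r; apply: IH.
have wa_gt0 : 0 < w a by rewrite lt_def wa_neq0 w0.
have := cA (F a) (S^-1 *: V) (w a / (w a + S)) _ _ (AF a) (IH S_gt0).
have -> : 1 - w a / (w a + S) = S / (w a + S).
  by rewrite -[X in X - _](divff (lt0r_neq0 wS0)) -mulrBl addrC addKr.
rewrite scalerDr !scalerA mulrAC divff ?gt_eqF// mul1r [w a / _]mulrC; apply.
  by rewrite mulr_gt0 ?invr_gt0.
by rewrite mulrC ltr_pdivrMr// mul1r ltrDl.
Qed.

Lemma convex_hull_sub (R : realType) (E : lmodType R) (S A : set E) :
  convex_set A -> S `<=` A -> convex_hull S `<=` A.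
Proof. exact: smallest_sub. Qed.

(** As [0 < t < 1], either of the two final equalities implies the other. *)
Definition extreme_point (R : realType) (E : lmodType R) (P : set E) (v : E) :=
  P v /\ forall x y t, P x -> P y -> 0 < t -> t < 1 ->
    v = t *: x + (1 - t) *: y -> x = v \/ y = v.

(** Removing an extreme point leaves a convex set. If [T] missed [v], its hull would lie in that
    smaller set. *)
Lemma extreme_point_generates (R : realType) (E : lmodType R) (P T : set E) v :
  convex_set P -> extreme_point P v -> generates P T -> T v.
Proof.
move=> /convex_setE cP [Pv extv] [_ hT]; apply: contrapT => nTv.
have : convex_hull T `<=` P `\ v.
  apply: convex_hull_sub.
    apply/convex_setE => x y t t0 t1 [Px xv] [Py yv]; split; first exact: cP.
    by move=> /= /esym /(extv x y t Px Py t0 t1)[].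
  move=> x Tx; split; first by rewrite -hT => V /= [_]; apply.
  by move=> /= xv; apply: nTv; rewrite -xv.
by rewrite hT => /(_ v Pv)[_]; apply.
Qed.

(** [S] lies in every generating set, which gives both minimality and uniqueness. *)
Lemma vertex_set_extreme (R : realType) (E : lmodType R) (P S : set E) :
  convex_set P -> generates P S -> S `<=` extreme_point P -> is_vertex_set P S.
Proof.
move=> cP gS extS.
have min T : generates P T -> S `<=` T.
  by move=> gT v /extS extv; apply: extreme_point_generates gT.
split; first by split=> // T TS gT; apply/seteqP; split=> //; apply: min.
by move=> T [gT minT]; apply: minT => //; apply: min.
Qed.

Lemma gardner_convex (R : realType) (d : nat) : convex_set (gardner_polytope R d).
Proof.
apply/convex_setE => A B t t0 t1 [A0 sA] [B0 sB]; split=> [i j|s].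
  by rewrite !mxE addr_ge0// mulr_ge0// ?subr_ge0 ltW.
under eq_bigr do rewrite !mxE.
by rewrite big_split/= -!mulr_sumr sA sB; lra.
Qed.

Lemma R_matrix_gardner (R : realType) (d : nat) (i : 'I_d) :
  gardner_polytope R d (R_matrix R i).
Proof.
split=> [k l|s]; first by rewrite mxE.
rewrite (bigD1 i)//= mxE eqxx big1 ?addr0// => k /negPf ki.
by rewrite mxE ki.
Qed.

Lemma C_matrix_gardner (R : realType) (d : nat) (j : 'I_d) :
  gardner_polytope R d (C_matrix R j).
Proof.
split=> [k l|s]; first by rewrite mxE.
rewrite (bigD1 (s^-1 j)%g)//= mxE permKV eqxx big1 ?addr0// => k kj.
by rewrite mxE; case: eqP => // skj; rewrite -skj permK eqxx in kj.
Qed.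

Lemma gardner_row_eq (R : realType) (d : nat) (A : 'M[R]_d) (i : 'I_d) :
  gardner_polytope R d A -> (forall k l, k != i -> A k l = 0) -> A = R_matrix R i.
Proof.
move=> [_ sA] A0; apply/matrixP => k l; rewrite mxE.
have [->|/A0//] := eqVneq k i.
(* This permutation sends [i] to [l], so [A i l] is the only term of its sum outside the zero
   rows. *)
have := sA (tperm i l); rewrite (bigD1 i)//= tpermL big1 ?addr0//.
by move=> m /A0.
Qed.

Lemma gardner_col_eq (R : realType) (d : nat) (A : 'M[R]_d) (j : 'I_d) :
  gardner_polytope R d A -> (forall k l, l != j -> A k l = 0) -> A = C_matrix R j.
Proof.
move=> [_ sA] A0; apply/matrixP => k l; rewrite mxE.
have [->|/A0//] := eqVneq l j.
have := sA (tperm k j); rewrite (bigD1 k)//= tpermL big1 ?addr0// => m mk.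
apply: A0; apply: contra_neq mk => mj.
by apply: (@perm_inj _ (tperm k j)); rewrite mj tpermL.
Qed.

Lemma conv_eq0 (R : realType) (t x y : R) :
  0 < t -> t < 1 -> 0 <= x -> 0 <= y -> t * x + (1 - t) * y = 0 -> x = 0.
Proof.
move=> t0 t1 x0 y0 /eqP.
rewrite paddr_eq0 ?mulr_ge0// ?subr_ge0 1?ltW// mulf_eq0 gt_eqF//=.
by case/andP => /eqP.
Qed.

(** Entries are nonnegative, so zeros of [v] are inherited by the endpoints of any segment through
    it; it suffices that the zero pattern determines [v]. *)
Lemma gardner_extreme (R : realType) (d : nat) (v : 'M[R]_d) :
  gardner_polytope R d v ->
  (forall A, gardner_polytope R d A ->
    (forall k l, v k l = 0 -> A k l = 0) -> A = v) ->
  extreme_point (gardner_polytope R d) v.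
Proof.
move=> Gv supp; split=> // A B t GA GB t0 t1 E; left; apply: supp => // k l.
rewrite E !mxE; apply: conv_eq0 => //; [exact: GA.1|exact: GB.1].
Qed.

Lemma R_matrix_extreme (R : realType) (d : nat) (i : 'I_d) :
  extreme_point (gardner_polytope R d) (R_matrix R i).
Proof.
apply: gardner_extreme => [|A GA A0]; first exact: R_matrix_gardner.
by apply: gardner_row_eq => // k l /negPf ki; rewrite A0// mxE ki.
Qed.

Lemma C_matrix_extreme (R : realType) (d : nat) (j : 'I_d) :
  extreme_point (gardner_polytope R d) (C_matrix R j).
Proof.
apply: gardner_extreme => [|A GA A0]; first exact: C_matrix_gardner.
by apply: gardner_col_eq => // k l /negPf lj; rewrite A0// mxE lj.
Qed.

Lemma ex_perm2 (T : finType) (i k j l : T) :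
  i != k -> j != l -> exists s : {perm T}, s i = j /\ s k = l.
Proof.
(* The first factor sends [i] to [j]; the second carries the image of [k] to [l] and fixes [j]. *)
move=> ik jl; exists (tperm i j * tperm (tperm i j k) l)%g.
rewrite !permM tpermL tpermD; last by rewrite eq_sym.
  by split=> //; rewrite tpermL.
by rewrite -(inj_eq (@perm_inj _ (tperm i j))) tpermK tpermR eq_sym.
Qed.

Lemma G_matrix_exchange (R : realType) (d : nat) (N : R) (A : 'M[R]_d) i j k l :
  G_matrix N A -> A i j + A k l = A i l + A k j.
Proof.
move=> [_ sA].
have [->|ik] := eqVneq i k; first by rewrite addrC.
have [->//|jl] := eqVneq j l.
have [s [<- <-]] := ex_perm2 ik jl.
(* The two permutations differ only at [i] and [k], where their values are swapped; the other terms
   cancel. *)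
have := sA (tperm i k * s)%g; rewrite -(sA s).
rewrite (bigD1 i)//= (bigD1 k) 1?eq_sym//= [RHS](bigD1 i)//= [in RHS](bigD1 k) 1?eq_sym//=.
rewrite !permM tpermL tpermR !addrA.
under eq_bigr => m /andP[mi mk] do rewrite permM tpermD 1?eq_sym//.
by move/addIr.
Qed.

Lemma G_matrix_decomp (R : realType) (d : nat) (N : R) (A : 'M[R]_d) :
  (0 < d)%N -> G_matrix N A ->
  exists r c : 'I_d -> R, [/\ forall i, 0 <= r i, forall j, 0 <= c j,
    \sum_i r i + \sum_j c j = N & forall i j, A i j = r i + c j].
Proof.
case: d A => // d A _ GA; have [A0 sA] := GA.
(* Column [m] holds a smallest entry of row [ord0]; it serves as [r], and the excess of that row
   over this entry as [c]. *)
case: (@Order.TotalTheory.arg_minP _ _ _ ord0 xpredT (A ord0)) => // m _ minA.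
have E i j : A i j = A i m + (A ord0 j - A ord0 m).
  by have := G_matrix_exchange i j ord0 m GA; lra.
exists (fun i => A i m), (fun j => A ord0 j - A ord0 m); split=> // [j|].
  by rewrite subr_ge0 minA.
(* The total weight is the sum along the identity permutation. *)
rewrite -big_split/= -(sA 1%g); apply: eq_bigr => i _.
by rewrite perm1 -E.
Qed.

Lemma gardner_hull (R : realType) (d : nat) :
  (0 < d)%N ->
  convex_hull (range (@R_matrix R d) `|` range (@C_matrix R d)) =
  gardner_polytope R d.
Proof.
move=> d0; apply/seteqP; split.
  apply: convex_hull_sub; first exact: gardner_convex.
  by move=> _ [] [i _ <-]; [apply: R_matrix_gardner|apply: C_matrix_gardner].
move=> A /(G_matrix_decomp d0)[r [c [r0 c0 rc E]]] V /= [cV SV].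
(* The disjoint sum indexes both families at once; at entry [(i, j)] only [R_matrix R i] and
   [C_matrix R j] contribute. *)
pose w (x : 'I_d + 'I_d) := match x with inl i => r i | inr j => c j end.
pose F (x : 'I_d + 'I_d) :=
  match x with inl i => R_matrix R i | inr j => C_matrix R j end.
have w1 : \sum_x w x = 1 by rewrite big_sumType.
have -> : A = (\sum_x w x)^-1 *: \sum_x w x *: F x.
  rewrite w1 invr1 scale1r big_sumType/=; apply/matrixP => i j.
  rewrite mxE !summxE E; congr (_ + _).
    rewrite (bigD1 i)//= !mxE eqxx mulr1 big1 ?addr0// => k ki.
    by rewrite !mxE eq_sym (negPf ki) mulr0.
  rewrite (bigD1 j)//= !mxE eqxx mulr1 big1 ?addr0// => k kj.
  by rewrite !mxE eq_sym (negPf kj) mulr0.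
apply: convex_set_sum => //; last by rewrite w1.
  by case.
by case=> i; apply: SV; [left|right]; exists i.
Qed.

Theorem theorem1 (R : realType) (d : nat) (hd : (1 <= d)%N) :
  is_vertex_set (gardner_polytope R d)
    (range (@R_matrix R d) `|` range (@C_matrix R d)).
Proof.
apply: vertex_set_extreme; first exact: gardner_convex.
  split; last exact: gardner_hull.
  by rewrite finite_setU; split; apply: finite_image.
by move=> _ [] [i _ <-]; [apply: R_matrix_extreme|apply: C_matrix_extreme].
Qed.
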